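(* Let $\{\mathbf u,\mathbf n,\mathbf b,\mathbf c\}$ be the Frenet--Serret tetrad of the time-like world-line of a particle in Minkowski space $M_4$, with curvature $a$, torsion $\tau$ and third curvature $\sigma$, and assume that $a$, $\tau$ and $\sigma$ are constant. Let $\chi,\omega,\varepsilon,\Gamma,\Lambda$ be the constants determined by $a,\tau,\sigma$ as in the context. Then the vectors $$f_0=\Gamma\mathbf u+\Lambda\mathbf b,$$ $$f_1=\Lambda\mathbf u+\Gamma\mathbf b,$$ $$f_2=a^{-1}[\Gamma\chi\,\mathbf n+\varepsilon\Lambda\omega\,\mathbf c],$$ $$f_3=a^{-1}[-\varepsilon\Lambda\omega\,\mathbf n+\Gamma\chi\,\mathbf c]$$ form a right-handed orthonormal frame such that $$\ddot f_0-\chi^2f_0=\ddot f_1+\omega^2f_1=0,$$ $$\ddot f_2-\chi^2f_2=\ddot f_3+\omega^2f_3=0.$$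
   Context: $M_4$ is Minkowski space with metric $\eta=\mathrm{diag}(-1,1,1,1)$. The world-line is parameterised by arc length (proper time) $s$; a dot denotes $d/ds$. $\mathbf u$, with components $u^a=dx^a/ds$, is the unit time-like tangent vector. The Frenet--Serret tetrad $\{\mathbf u,\mathbf n,\mathbf b,\mathbf c\}$ consists of mutually orthogonal vectors with $u^au_a=-1$, $n^an_a=b^ab_a=c^ac_a=1$, which form a right-handed frame and satisfy $$\dot{\mathbf u}=a\mathbf n,\quad \dot{\mathbf n}=a\mathbf u+\tau\mathbf b,\quad \dot{\mathbf b}=-\tau\mathbf n+\sigma\mathbf c,\quad \dot{\mathbf c}=-\sigma\mathbf b .$$ The curvature $a$ and torsion $\tau$ are nonnegative; $\varepsilon=-1$ if $\sigma<0$ and $\varepsilon=+1$ otherwise. The nonnegative real numbers $\chi,\omega$ are such that the four roots of $$(\lambda^2-a^2)(\lambda^2+\tau^2+\sigma^2)+(a\tau)^2=0$$ are $\pm\chi,\pm i\omega$; explicitly, with $\Delta=\sqrt{(a^2-\tau^2-\sigma^2)^2+4a^2\sigma^2}$, $$\chi^2=\tfrac12[a^2-\tau^2-\sigma^2+\Delta],\qquad \omega^2=-\tfrac12[a^2-\tau^2-\sigma^2-\Delta],$$ so that $\chi^2-\omega^2=a^2-\tau^2-\sigma^2$, $a\sigma=\varepsilon\omega\chi$ and $\chi^2+\omega^2=\Delta$. The positive numbers $\Gamma,\Lambda$ are defined by $$\Gamma^2=\frac{a^2+\omega^2}{\chi^2+\omega^2},\qquad \Lambda^2=\frac{a^2-\chi^2}{\chi^2+\omega^2},$$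 so that $\Gamma^2-\Lambda^2=1$. It is understood that $a\neq0$ and $\chi^2+\omega^2\neq0$, so that these expressions and the vectors $f_k$ are defined.
   Formalization: Right-handedness is stated for the order (f_0, f_2, f_1, f_3): in the listed order (f_0, f_1, f_2, f_3) the frame is left-handed, e.g. for τ=σ=0 it is (u, b, n, c). *)

(* Defs.v *)
From HB Require Import structures.
From mathcomp Require Import all_boot all_order all_algebra.
From mathcomp Require Import all_classical all_reals all_analysis.
From mathcomp Require Import ring lra.
Import Order.TTheory GRing.Theory Num.Theory.
Import numFieldNormedType.Exports.

Set Implicit Arguments.
Unset Strict Implicit.
Unset Printing Implicit Defensive.

Local Open Scope ring_scope.
Local Open Scope classical_set_scope.

Section Minkowski.
Context {R : realType}.

Definition eta : 'M[R]_4 :=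
  \matrix_(i, j) if i == j then (if i == 0 then -1 else 1) else 0.

Definition mdot (v w : 'rV[R]_4) : R := (v *m eta *m w^T) 0 0.

Definition frame (e0 e1 e2 e3 : 'rV[R]_4) : 'M[R]_4 :=
  \matrix_(i < 4) nth 0 [:: e0; e1; e2; e3] i.

(* The first vector is the time-like one. *)
Definition minkowski_orthonormal (e0 e1 e2 e3 : 'rV[R]_4) : Prop :=
  let E := frame e0 e1 e2 e3 in
  forall i j, mdot (row i E) (row j E) = eta i j.

(* Positive orientation with respect to the coordinate basis; the order of the
   four vectors matters. *)
Definition right_handed (e0 e1 e2 e3 : 'rV[R]_4) : Prop :=
  0 < \det (frame e0 e1 e2 e3).

Record frenet_serret (J : set R) (x u n b c : R -> 'rV[R]_4)
    (curv tors hyper : R -> R) : Prop := FrenetSerret {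
  fs_curv_ge0 : forall s, J s -> 0 <= curv s;
  fs_tors_ge0 : forall s, J s -> 0 <= tors s;
  fs_orthonormal : forall s, J s ->
    minkowski_orthonormal (u s) (n s) (b s) (c s);
  fs_right_handed : forall s, J s -> right_handed (u s) (n s) (b s) (c s);
  fs_x : forall s, J s -> is_derive s 1 x (u s);
  fs_u : forall s, J s -> is_derive s 1 u (curv s *: n s);
  fs_n : forall s, J s -> is_derive s 1 n (curv s *: u s + tors s *: b s);
  fs_b : forall s, J s -> is_derive s 1 b (- tors s *: n s + hyper s *: c s);
  fs_c : forall s, J s -> is_derive s 1 c (- hyper s *: b s)
}.

(* derive1 is a total operator, so an equation on second derivatives has to come
   with this. *)
Definition twice_derivable (J : set R) (f : R -> 'rV[R]_4) : Prop :=
  forall s, J s -> derivable f s 1 /\ derivable (derive1 f) s 1.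

End Minkowski.

Section Constants.
Context {R : realType}.
Variables a tau sigma : R.

Definition Delta : R :=
  Num.sqrt ((a ^+ 2 - tau ^+ 2 - sigma ^+ 2) ^+ 2
            + 4 * a ^+ 2 * sigma ^+ 2).

(* Every radicand below is nonnegative (for the last two, as soon as Delta,
   which equals chi ^+ 2 + omega ^+ 2, is nonzero), so these are the nonnegative
   numbers with the prescribed squares. *)
Definition chi : R :=
  Num.sqrt (2^-1 * (a ^+ 2 - tau ^+ 2 - sigma ^+ 2 + Delta)).

Definition omega : R :=
  Num.sqrt (- 2^-1 * (a ^+ 2 - tau ^+ 2 - sigma ^+ 2 - Delta)).

Definition epsilon : R := if sigma < 0 then -1 else 1.

Definition Gam : R :=
  Num.sqrt ((a ^+ 2 + omega ^+ 2) / (chi ^+ 2 + omega ^+ 2)).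

(* Lam vanishes when tau = 0 and a ^+ 2 >= sigma ^+ 2. *)
Definition Lam : R :=
  Num.sqrt ((a ^+ 2 - chi ^+ 2) / (chi ^+ 2 + omega ^+ 2)).

(* The roots of the characteristic quartic of the Frenet-Serret system are
   +- chi and +- i omega. *)
Lemma quartic_chi_omega (l : R) :
  (l ^+ 2 - a ^+ 2) * (l ^+ 2 + tau ^+ 2 + sigma ^+ 2) + (a * tau) ^+ 2 =
  (l ^+ 2 - chi ^+ 2) * (l ^+ 2 + omega ^+ 2).
Proof.
set d := a ^+ 2 - tau ^+ 2 - sigma ^+ 2.
have as_ge0 : 0 <= 4 * a ^+ 2 * sigma ^+ 2.
  by rewrite -mulrA -exprMn mulr_ge0 // sqr_ge0.
have D2 : Delta ^+ 2 = d ^+ 2 + 4 * a ^+ 2 * sigma ^+ 2.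
  by rewrite sqr_sqrtr // addr_ge0 ?sqr_ge0.
have : `|d| <= Delta by rewrite -(sqrtr_sqr d) ler_wsqrtr // lerDl.
rewrite ler_norml => /andP[dN dP].
rewrite sqr_sqrtr; last by rewrite -/d; lra.
rewrite sqr_sqrtr; last by rewrite -/d; lra.
rewrite -/d (_ : (_ - _) * (l ^+ 2 + _) =
  l ^+ 4 - d * l ^+ 2 + 4^-1 * (d ^+ 2 - Delta ^+ 2)); last by field.
by rewrite D2 /d; field.
Qed.

Variables u n b c : R -> 'rV[R]_4.

Definition f0 (s : R) : 'rV[R]_4 := Gam *: u s + Lam *: b s.

Definition f1 (s : R) : 'rV[R]_4 := Lam *: u s + Gam *: b s.

(* Since f0, f1 span the same plane as u, b and f2, f3 the same plane as n, c,
   with unit determinants, f0 /\ f2 /\ f1 /\ f3 = u /\ n /\ b /\ c: the frame has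
   the orientation of the tetrad (u, n, b, c) when listed as (f0, f2, f1, f3),
   and the opposite one when listed by increasing index. *)
Definition f2 (s : R) : 'rV[R]_4 :=
  a^-1 *: ((Gam * chi) *: n s + (epsilon * Lam * omega) *: c s).

Definition f3 (s : R) : 'rV[R]_4 :=
  a^-1 *: (- (epsilon * Lam * omega) *: n s + (Gam * chi) *: c s).

End Constants.

(* Main.v *)
Require Import Defs.
From mathcomp Require Import all_boot all_order all_algebra.
From mathcomp Require Import all_classical all_reals all_analysis.
From mathcomp Require Import ring lra.
Import Order.TTheory GRing.Theory Num.Theory.
Import numFieldNormedType.Exports.

Local Open Scope ring_scope.
Local Open Scope classical_set_scope.

(** Along the world-line the new frame splits into two planes: with
    e = epsilon,
      f0' = chi f2,       f2' = chi f0,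
      f1' = e omega f3,   f3' = - e omega f1,
    from which the second-order equations are read off.  These four relations,
    and orthonormality, reduce to the algebraic identities
      a tau = Gam Lam (chi^2 + omega^2)   and   a sigma = e omega chi,
    which are the values of the characteristic quartic at a and at 0 together
    with the signs of the square roots. *)

(** * Algebra of the constants determined by the three curvatures *)

Section Constants.
Context {R : realType}.
Variables a tau sigma : R.

Local Notation X := (chi a tau sigma).
Local Notation W := (omega a tau sigma).
Local Notation G := (Gam a tau sigma).
Local Notation L := (Lam a tau sigma).
Local Notation e := (epsilon sigma).

Lemma epsilon_sqr : e ^+ 2 = 1.
Proof. by rewrite /epsilon; case: ifP => _; rewrite ?sqrrN expr1n. Qed.

Lemma epsilon_normr : e * `|sigma| = sigma.
Proof.
rewrite /epsilon; case: ltP => [s0|s0].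
  by rewrite ltr0_norm// mulN1r opprK.
by rewrite ger0_norm// mul1r.
Qed.

Hypothesis D_neq0 : X ^+ 2 + W ^+ 2 != 0.

Lemma chi_omega_gt0 : 0 < X ^+ 2 + W ^+ 2.
Proof. by rewrite lt_neqAle eq_sym D_neq0 addr_ge0 ?sqr_ge0. Qed.

Lemma Gam_sqr : G ^+ 2 * (X ^+ 2 + W ^+ 2) = a ^+ 2 + W ^+ 2.
Proof.
rewrite sqr_sqrtr; last by rewrite divr_ge0 ?addr_ge0 ?sqr_ge0.
by rewrite divfK.
Qed.

Hypothesis a_gt0 : 0 < a.

Lemma quartic_at_curvature :
  (a ^+ 2 - X ^+ 2) * (a ^+ 2 + W ^+ 2) = (a * tau) ^+ 2.
Proof. by rewrite -quartic_chi_omega subrr mul0r add0r. Qed.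

Lemma Lam_sqr : L ^+ 2 * (X ^+ 2 + W ^+ 2) = a ^+ 2 - X ^+ 2.
Proof.
have aW_gt0 : 0 < a ^+ 2 + W ^+ 2 by rewrite ltr_wpDr ?sqr_ge0 ?exprn_gt0.
rewrite sqr_sqrtr ?divfK// divr_ge0 ?(ltW chi_omega_gt0)//.
(* The sign of [a ^+ 2 - X ^+ 2] comes from the quartic at [a]: its product with the positive
   [a ^+ 2 + W ^+ 2] is a square. *)
by rewrite -(pmulr_lge0 _ aW_gt0) quartic_at_curvature sqr_ge0.
Qed.

Lemma Gam_Lam_sqr : G ^+ 2 - L ^+ 2 = 1.
Proof.
apply: (mulIf D_neq0); rewrite mulrBl Gam_sqr Lam_sqr; ring.
Qed.

(** With [sigma] split as [e] times its absolute value, the factor [e] cancels and both remaining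
    sides are nonnegative, so it suffices to compare squares. The quartic at 0 gives exactly a^2
    sigma^2 = X^2 W^2. *)
Lemma curv_hyper : a * sigma = e * (W * X).
Proof.
rewrite -[in LHS]epsilon_normr mulrCA; congr (_ * _).
apply: (@pexpIrn _ 2);
  rewrite ?nnegrE ?mulr_ge0 ?sqrtr_ge0 ?normr_ge0 ?(ltW a_gt0)//.
have := quartic_chi_omega a tau sigma 0.
by rewrite !exprMn real_normK ?num_real// => q; lra.
Qed.

Hypothesis tau_ge0 : 0 <= tau.

(** Both sides are nonnegative, and the square of the right one is the product of the values in
    [Gam_sqr] and [Lam_sqr], which the quartic at [a] identifies with (a tau)^2. *)
Lemma curv_tors : a * tau = G * L * (X ^+ 2 + W ^+ 2).
Proof.
apply: (@pexpIrn _ 2);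
  rewrite ?nnegrE ?mulr_ge0 ?addr_ge0 ?sqr_ge0 ?sqrtr_ge0 ?(ltW a_gt0)//.
rewrite -quartic_at_curvature -Gam_sqr -Lam_sqr; ring.
Qed.

Lemma curv_tors_Lam : a * tau * L = G * (a ^+ 2 - X ^+ 2).
Proof. rewrite curv_tors -Lam_sqr; ring. Qed.

Lemma curv_tors_Gam : a * tau * G = L * (a ^+ 2 + W ^+ 2).
Proof. rewrite curv_tors -Gam_sqr; ring. Qed.

(** Cleared of denominators, the left side is (a^2 + W^2) X^2 + (a^2 - X^2) W^2, whose X^2 W^2 terms
    cancel. Division by a^2 then turns the passage from [n], [c] to [f2], [f3] into a rotation. *)
Lemma rotation_sqr : (G * X) ^+ 2 + (e * L * W) ^+ 2 = a ^+ 2.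
Proof.
apply: (mulIf D_neq0); rewrite !exprMn epsilon_sqr.
transitivity (G ^+ 2 * (X ^+ 2 + W ^+ 2) * X ^+ 2
              + L ^+ 2 * (X ^+ 2 + W ^+ 2) * W ^+ 2); first by ring.
rewrite Gam_sqr Lam_sqr; ring.
Qed.

End Constants.

(** * Second derivatives from a pair of first-order equations *)

Section Derivatives.
Context {R : realType}.

Lemma is_derive_lincomb {V W : normedModType R} {f g : V -> W} {x v : V}
    {df dg : W} (k l : R) {d : W} :
  is_derive x v f df -> is_derive x v g dg -> k *: df + l *: dg = d ->
  is_derive x v (fun t => k *: f t + l *: g t) d.
Proof. by move=> hf hg <-; exact: is_deriveD. Qed.

(** Differentiate the first relation and substitute the second. Openness of [J] makes [derive1 f]
    agree with [k *: g] on a whole neighbourhood of [s], which is what differentiating it again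
    requires. *)
Lemma coupled_derive2 {J : set R} {f g : R -> 'rV[R]_4} {k l : R} :
  open J ->
  (forall s, J s -> is_derive s 1 f (k *: g s)) ->
  (forall s, J s -> is_derive s 1 g (l *: f s)) ->
  twice_derivable J f /\ forall s, J s -> derive1n 2 f s = (k * l) *: f s.
Proof.
move=> Jo hf hg.
have h2 s : J s -> is_derive s 1 (derive1 f) ((k * l) *: f s).
  move=> Js.
  have hkg : is_derive s 1 (fun t => k *: g t) ((k * l) *: f s).
    by rewrite -scalerA; have := hg _ Js => ?; exact: is_deriveZ.
  apply: near_eq_is_derive hkg; near=> t; rewrite derive1E.
  have Jt : J t by near: t; exact: open_nbhs_nbhs.
  by have [_ ->] := hf _ Jt.
split=> s Js.
  by split; [case: (hf s Js) => + _; exact | case: (h2 s Js) => + _; exact].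
by rewrite derive1nS /= derive1E; have [_ ->] := h2 _ Js.
Unshelve. all: by end_near. Qed.

End Derivatives.

(** * Boosts and rotations acting on orthonormal frames *)

Section Frames.
Context {R : realType}.
Implicit Types u n b c v w : 'rV[R]_4.

Lemma mdotDl v v' w : mdot (v + v') w = mdot v w + mdot v' w.
Proof. by rewrite /mdot !mulmxDl mxE. Qed.

Lemma mdotDr v w w' : mdot v (w + w') = mdot v w + mdot v w'.
Proof. by rewrite /mdot linearD mulmxDr mxE. Qed.

Lemma mdotZl k v w : mdot (k *: v) w = k * mdot v w.
Proof. by rewrite /mdot -!scalemxAl mxE. Qed.

Lemma mdotZr k v w : mdot v (k *: w) = k * mdot v w.
Proof. by rewrite /mdot linearZ -scalemxAr mxE. Qed.

Lemma minkowski_orthonormalP e0 e1 e2 e3 :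
  minkowski_orthonormal e0 e1 e2 e3 <->
  forall i j : nat, (i < 4)%N -> (j < 4)%N ->
    mdot (nth 0 [:: e0; e1; e2; e3] i) (nth 0 [:: e0; e1; e2; e3] j) =
    (if i == j then (if i == 0%N then -1 else 1) else 0 : R).
Proof.
split=> [H i j hi hj | H E i j].
  by have := H (Ordinal hi) (Ordinal hj); rewrite !rowK mxE.
by rewrite /E !rowK mxE; exact: H.
Qed.

(* Columns are indexed by (u, n, b, c) and rows by (f0, f2, f1, f3). *)
Definition boost_rotation (g l p q : R) : 'M[R]_4 :=
  \matrix_(i, j) nth 0 (nth [::] [:: [:: g; 0; l; 0]; [:: 0; p; 0; q];
                                     [:: l; 0; g; 0]; [:: 0; - q; 0; p]] i) j.

(** The matrix is a boost block on the indices 0, 2 and a rotation block on 1, 3. Rows and columns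
    are interleaved in the same way, so the block determinants multiply without a sign. *)
Lemma det_boost_rotation g l p q :
  \det (boost_rotation g l p q) = (g ^+ 2 - l ^+ 2) * (p ^+ 2 + q ^+ 2).
Proof.
do 4! rewrite !(expand_det_row _ ord0) !big_ord_recl !big_ord0 /cofactor !mxE
  /= ?mul0r ?addr0 ?add0r.
rewrite !det_mx00 /bump /=; ring.
Qed.

Lemma orthonormal_boost_rotation u n b c g l p q :
  minkowski_orthonormal u n b c ->
  g ^+ 2 - l ^+ 2 = 1 -> p ^+ 2 + q ^+ 2 = 1 ->
  minkowski_orthonormal (g *: u + l *: b) (l *: u + g *: b)
    (p *: n + q *: c) (- q *: n + p *: c).
Proof.
move=> /minkowski_orthonormalP H gl pq.
have := (H 0 0 isT isT, H 0 1 isT isT, H 0 2 isT isT, H 0 3 isT isT)%N.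
have := (H 1 0 isT isT, H 1 1 isT isT, H 1 2 isT isT, H 1 3 isT isT)%N.
have := (H 2 0 isT isT, H 2 1 isT isT, H 2 2 isT isT, H 2 3 isT isT)%N.
have := (H 3 0 isT isT, H 3 1 isT isT, H 3 2 isT isT, H 3 3 isT isT)%N.
move=> /= Hc Hb Hn Hu; apply/minkowski_orthonormalP.
(* By bilinearity, each of the sixteen products either cancels to 0 or reduces, up to sign, to [gl]
   or [pq]. *)
do 2! case=> [|[|[|[|]]]] //=; move=> _ _;
  rewrite !(mdotDl, mdotDr, mdotZl, mdotZr) !(Hu, Hn, Hb, Hc).
all: lra.
Qed.

Lemma frame_boost_rotation u n b c g l p q :
  frame (g *: u + l *: b) (p *: n + q *: c) (l *: u + g *: b)
    (- q *: n + p *: c) = boost_rotation g l p q *m frame u n b c.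
Proof.
apply/row_matrixP => i; rewrite row_mul rowK mulmx_sum_row.
rewrite !big_ord_recl big_ord0 !rowK !mxE.
case: i => [[|[|[|[|]]]]] //= _; rewrite !scale0r ?add0r ?addr0//.
Qed.

Lemma right_handed_boost_rotation u n b c g l p q :
  right_handed u n b c -> g ^+ 2 - l ^+ 2 = 1 -> p ^+ 2 + q ^+ 2 = 1 ->
  right_handed (g *: u + l *: b) (p *: n + q *: c) (l *: u + g *: b)
    (- q *: n + p *: c).
Proof.
move=> rh gl pq.
by rewrite /right_handed frame_boost_rotation det_mulmx det_boost_rotation
  gl pq !mul1r.
Qed.

End Frames.

(** * The new frame along a world-line with constant curvatures *)

Theorem theorem2 (R : realType) (J : set R) (x u n b c : R -> 'rV[R]_4)
    (curv tors hyper : R -> R) (a tau sigma : R)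
    (J_open : open J) (J_itv : is_interval J)
    (FS : frenet_serret J x u n b c curv tors hyper)
    (curv_cst : forall s, J s -> curv s = a)
    (tors_cst : forall s, J s -> tors s = tau)
    (hyper_cst : forall s, J s -> hyper s = sigma)
    (a_neq0 : a != 0)
    (chi_omega_neq0 : chi a tau sigma ^+ 2 + omega a tau sigma ^+ 2 != 0) :
  let X := chi a tau sigma in
  let W := omega a tau sigma in
  let f_0 := f0 a tau sigma u b in
  let f_1 := f1 a tau sigma u b in
  let f_2 := f2 a tau sigma n c in
  let f_3 := f3 a tau sigma n c in
  [/\ forall s, J s -> minkowski_orthonormal (f_0 s) (f_1 s) (f_2 s) (f_3 s),
      forall s, J s -> right_handed (f_0 s) (f_2 s) (f_1 s) (f_3 s),
      [/\ twice_derivable J f_0, twice_derivable J f_1,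
          twice_derivable J f_2 & twice_derivable J f_3] &
      forall s, J s ->
        [/\ derive1n 2 f_0 s - X ^+ 2 *: f_0 s = 0,
            derive1n 2 f_1 s + W ^+ 2 *: f_1 s = 0,
            derive1n 2 f_2 s - X ^+ 2 *: f_2 s = 0 &
            derive1n 2 f_3 s + W ^+ 2 *: f_3 s = 0]].
Proof.
move=> X W f_0 f_1 f_2 f_3.
(* The signs of [a] and [tau] are read off at a point of [J], so the empty set is treated apart. *)
have [J0|/set0P[s0 Js0]] := eqVneq J set0.
  have NJ s : ~ J s by rewrite J0.
  by split; [ | | split | ] => s /NJ.
have a_gt0 : 0 < a.
  by rewrite lt_neqAle eq_sym a_neq0 -(curv_cst _ Js0) (fs_curv_ge0 FS).
have tau_ge0 : 0 <= tau by rewrite -(tors_cst _ Js0) (fs_tors_ge0 FS).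
pose e := epsilon sigma.
pose G := Gam a tau sigma; pose L := Lam a tau sigma.
have GL : G ^+ 2 - L ^+ 2 = 1 by exact: Gam_Lam_sqr.
(* [p] and [q] are the cosine and sine of the rotation from [n], [c] to [f_2], [f_3]. *)
pose p := a^-1 * (G * X).
pose q := a^-1 * (e * L * W).
have pq : p ^+ 2 + q ^+ 2 = 1.
  rewrite /p /q exprMn [X in _ + X]exprMn -mulrDr rotation_sqr//.
  by rewrite exprVn mulVf ?expf_neq0.
have apE : a * p = G * X by rewrite mulVKf.
have aqE : a * q = e * L * W by rewrite mulVKf.
have f2E s : f_2 s = p *: n s + q *: c s.
  by rewrite /f_2 /f2 scalerDr !scalerA.
have f3E s : f_3 s = - q *: n s + p *: c s.
  by rewrite /f_3 /f3 scalerDr !scalerA mulrN.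
have du s : J s -> is_derive s 1 u (a *: n s).
  by move=> Js; rewrite -(curv_cst _ Js); exact: (fs_u FS).
have dn s : J s -> is_derive s 1 n (a *: u s + tau *: b s).
  by move=> Js; rewrite -(curv_cst _ Js) -(tors_cst _ Js); exact: (fs_n FS).
have db s : J s -> is_derive s 1 b (- tau *: n s + sigma *: c s).
  by move=> Js; rewrite -(tors_cst _ Js) -(hyper_cst _ Js); exact: (fs_b FS).
have dc s : J s -> is_derive s 1 c (- sigma *: b s).
  by move=> Js; rewrite -(hyper_cst _ Js); exact: (fs_c FS).
have as_eWX := curv_hyper _ tau _ a_gt0 : a * sigma = e * (W * X).
have atL := curv_tors_Lam _ _ _ chi_omega_neq0 a_gt0 tau_ge0.
have atG := curv_tors_Gam _ _ _ chi_omega_neq0 a_gt0 tau_ge0.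
have ee : e ^+ 2 = 1 := epsilon_sqr _.
rewrite -/X -/W -/G -/L in atL atG.
have aa_neq0 : a ^+ 2 != 0 by rewrite expf_neq0.
(* The next six identities match coefficients in the first-order relations: [f0n] is the coefficient
   of [n] in the derivative of [f_0], and so on. The coefficients of [u] are already given by [apE]
   and [aqE]. *)
have f0n : a * G - tau * L = X * p.
  apply: (mulfI a_neq0); have := congr1 ( *%R X) apE; lra.
have f0c : sigma * L = X * q.
  apply: (mulfI a_neq0).
  have := (congr1 ( *%R L) as_eWX, congr1 ( *%R X) aqE); case; lra.
(* One factor [a] completes [a * tau] and [a * sigma], the other clears the denominators of [p] and
   [q]. *)
have f2b : tau * p - sigma * q = X * L.
  apply: (mulfI aa_neq0).
  have -> : a ^+ 2 * (tau * p - sigma * q) =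
            a * tau * (a * p) - a * sigma * (a * q).
    ring.
  rewrite as_eWX apE aqE.
  have := (congr1 ( *%R X) atG, congr1 ( *%R (L * W ^+ 2 * X)) ee); case; lra.
have f1n : a * L - tau * G = - (e * W * q).
  apply: (mulfI a_neq0).
  have := (congr1 ( *%R (e * W)) aqE, congr1 ( *%R (L * W ^+ 2)) ee); case; lra.
have f1c : sigma * G = e * W * p.
  apply: (mulfI a_neq0).
  have := (congr1 ( *%R G) as_eWX, congr1 ( *%R (e * W)) apE); case; lra.
have f3b : tau * q + sigma * p = e * W * G.
  apply: (mulfI aa_neq0).
  have -> : a ^+ 2 * (tau * q + sigma * p) =
            a * tau * (a * q) + a * sigma * (a * p).
    ring.
  rewrite as_eWX apE aqE.
  have := congr1 ( *%R (e * W)) atL; lra.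
have df0 s : J s -> is_derive s 1 f_0 (X *: f_2 s).
  move=> Js; apply: (is_derive_lincomb G L (du s Js) (db s Js)).
  rewrite f2E !scalerDr !scalerA addrA -scalerDl.
  by congr (_ *: _ + _ *: _); lra.
have df1 s : J s -> is_derive s 1 f_1 ((e * W) *: f_3 s).
  move=> Js; apply: (is_derive_lincomb L G (du s Js) (db s Js)).
  rewrite f3E !scalerDr !scalerA addrA -scalerDl.
  by congr (_ *: _ + _ *: _); lra.
have df2 s : J s -> is_derive s 1 f_2 (X *: f_0 s).
  move=> Js; rewrite (funext f2E).
  apply: (is_derive_lincomb p q (dn s Js) (dc s Js)).
  rewrite /f_0 /f0 -/G -/L !scalerDr !scalerA -addrA -scalerDl.
  by congr (_ *: _ + _ *: _); lra.
have df3 s : J s -> is_derive s 1 f_3 (- (e * W) *: f_1 s).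
  move=> Js; rewrite (funext f3E).
  apply: (is_derive_lincomb (- q) p (dn s Js) (dc s Js)).
  rewrite /f_1 /f1 -/G -/L !scalerDr !scalerA -addrA -scalerDl.
  by congr (_ *: _ + _ *: _); lra.
(* Each coupled pair is used in both orders; the products of its coefficients are X^2 and -(e
   W)^2. *)
have [tw0 dd0] := coupled_derive2 J_open df0 df2.
have [tw1 dd1] := coupled_derive2 J_open df1 df3.
have [tw2 dd2] := coupled_derive2 J_open df2 df0.
have [tw3 dd3] := coupled_derive2 J_open df3 df1.
have eW2 : (e * W) ^+ 2 = W ^+ 2 by rewrite exprMn ee mul1r.
split=> // s Js.
- rewrite f2E f3E; apply: orthonormal_boost_rotation => //.
  exact: (fs_orthonormal FS).
- rewrite f2E f3E; apply: right_handed_boost_rotation => //.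
  exact: (fs_right_handed FS).
- by rewrite dd0// dd1// dd2// dd3// mulrN mulNr -!expr2 eW2 !scaleNr !addNr
    !subrr.
Qed.
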